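(* Let $D$ be a connected locally semicomplete digraph that is not strong, and let $C_1,C_2,\dots,C_\ell$ be the acyclic ordering of the strong components of $D$. Then every oriented $(C_1,C_\ell)$-path $P$ in $D$ has at least $d(C_1,C_\ell)$ forward arcs.
   Context: For $x\in V(D)$, $N^+(x)=\{y: xy\in A(D)\}$, $N^-(x)=\{y: yx\in A(D)\}$. A semicomplete digraph is obtained from a complete graph by replacing each edge by one or both of its orientations. $D$ is locally semicomplete if $D[N^+(x)]$ and $D[N^-(x)]$ are semicomplete for every $x$. $D$ is connected if its underlying undirected graph is connected and strong if there is a directed path between every ordered pair of vertices. An acyclic ordering $C_1,\dots,C_\ell$ of the strong components (maximal strong subdigraphs) is one with no arc from $C_j$ to $C_i$ for $i<j$. For vertex-disjoint subgraphs $S,T$, an $(S,T)$-path is a directed path $p_1\dots p_t$ with $p_1\in V(S)$, $p_t\in V(T)$ and all other vertices outside $S\cup T$, and $d(S,T)$ is the length of a shortest $(S,T)$-path. An oriented $(S,T)$-path is an oriented path $p_1p_2\dots p_t$ (distinct vertices, consecutive ones adjacent in $D$) with $p_1\in V(S)$, $p_t\in V(T)$ and all other vertices outside $S\cup T$; the arc between $p_i$ and $p_{i+1}$ is forward if $p_ip_{i+1}\in A(D)$ and backward otherwise. *)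

(* Defs.v *)
From mathcomp Require Import all_boot.

Set Implicit Arguments.
Unset Strict Implicit.
Unset Printing Implicit Defensive.

(* A finite digraph is a finType T of vertices with an irreflexive arc relation
   e : rel T; both e x y and e y x may hold (opposite arcs are allowed). *)

Section Digraph.
Variables (T : finType) (e : rel T).

Definition out_nbh (x : T) : {set T} := [set y | e x y].
Definition in_nbh (x : T) : {set T} := [set y | e y x].

Definition adjacent : rel T := [rel x y | e x y || e y x].

Definition induced (S : {set T}) : rel T :=
  [rel x y | [&& x \in S, y \in S & e x y]].

Definition semicomplete_on (S : {set T}) : bool :=
  [forall x in S, forall y in S, (x != y) ==> adjacent x y].

Definition locally_semicomplete : bool :=
  [forall x, semicomplete_on (out_nbh x) && semicomplete_on (in_nbh x)].

Definition connected : bool := [forall x, forall y, connect adjacent x y].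

Definition strong_on (S : {set T}) : bool :=
  [forall x in S, forall y in S, connect (induced S) x y].

Definition strong : bool := strong_on [set: T].

(* Strong components are given by their vertex sets. Singletons are strong, so
   a component is nonempty as soon as T is. *)
Definition strong_component (C : {set T}) : bool := maxset strong_on C.

Definition acyclic_ordering (Cs : seq {set T}) : Prop :=
  [/\ uniq Cs,
      forall C : {set T}, (C \in Cs) = strong_component C
    & pairwise
        (fun A B : {set T} => [forall x in A, forall y in B, ~~ e y x]) Cs].

End Digraph.

(* The path is x :: s, of length size s; behead (belast x s) lists its vertices
   other than the two ends. *)
Definition is_path_between (T : finType) (r : rel T) (A B : {set T})
    (x : T) (s : seq T) : bool :=
  [&& path r x s, uniq (x :: s), x \in A, last x s \in B
    & all [pred v | v \notin A :|: B] (behead (belast x s))].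

Definition directed_path_between (T : finType) (e : rel T) :=
  is_path_between e.

Definition oriented_path_between (T : finType) (e : rel T) :=
  is_path_between (adjacent e).

(* Directed paths have length < #|T|, so the value #|T| plays the role of
   infinity: it is taken exactly when there is no directed (A, B)-path. *)
Definition dist (T : finType) (e : rel T) (A B : {set T}) : nat :=
  \big[minn/#|T|]_(n < #|T| |
      [exists x, exists s : n.-tuple T, directed_path_between e A B x s]) n.

Definition nb_forward (T : finType) (e : rel T) (x : T) (s : seq T) : nat :=
  count id (pairmap e x s).

(* Main.v *)
Require Import Defs.
From mathcomp Require Import all_boot.

(** Call [v] reachable within [k] if a directed walk of length at most [k] leads
    from the initial component [C_1] to [v].  A forward arc raises such a [k] by
    at most one.  A backward step [u, v], with [v -> u], does not raise it: if
    [w -> u] is the last arc of the walk to [u], then [v] and [w] are both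
    in-neighbours of [u], so either [v = w], or [w -> v], or [v -> w] and one
    recurses on the shorter walk to [w]; the recursion cannot end with an arc
    entering [C_1] from outside.  Hence the end of [P] is reachable within the
    number of forward arcs of [P], and trimming the walk gives a
    [(C_1, C_l)]-path that is no longer. *)

Lemma bigminn_le_cond {I : eqType} {r : seq I} {P : pred I} (F : I -> nat)
    {x : nat} {i : I} :
  i \in r -> P i -> \big[minn/x]_(j <- r | P j) F j <= F i.
Proof.
elim: r => // j r IHr; rewrite inE big_cons => /predU1P[<- -> | ri Pi].
  exact: geq_minl.
case: ifP => _; last exact: IHr.
by rewrite geq_min IHr ?orbT.
Qed.

(** Distinct vertices force [size s < #|T|], so [size s] is in the range of the minimum. *)
Lemma dist_le {T : finType} {e : rel T} {A B : {set T}} {x : T} {s : seq T} :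
  directed_path_between e A B x s -> dist e A B <= size s.
Proof.
move=> dP; have /and3P[_ Us _] := dP.
have ltsT : size s < #|T| by have := max_card (mem (x :: s)); rewrite (card_uniqP Us).
apply: (bigminn_le_cond (@nat_of_ord _) (i := Ordinal ltsT)).
  exact: mem_index_enum.
by apply/existsP; exists x; apply/existsP; exists (in_tuple s).
Qed.

(** Repetitions are removed first. At an inner vertex in [A] the part before it is dropped, at one
    in [B] the part after it; either cut shortens the walk, so induction on length applies. *)
Lemma directed_path_of_walk {T : finType} {e : rel T} {A B : {set T}}
    {x : T} {s : seq T} :
  x \in A -> path e x s -> last x s \in B ->
  exists x' s', directed_path_between e A B x' s' /\ size s' <= size s.
Proof.
have [n] := ubnP (size s); elim: n => // n IHn in x s *.
rewrite ltnS => les_n Ax pxs; case/shortenP: pxs => p pxp Up sub_ps Bp.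
have le_ps : size p <= size s by apply: uniq_leq_size sub_ps; case/andP: Up.
have [inner | ] := boolP (all [pred v | v \notin A :|: B] (behead (belast x p))).
  exists x, p; split=> //.
  by rewrite /directed_path_between /is_path_between pxp Up Ax Bp.
case/allPn=> v vp; rewrite /= negbK => ABv.
(* With the end [z] split off, the inner vertices are exactly those of [q]. *)
case/lastP: p => [|q z] // in vp pxp Up sub_ps Bp le_ps *.
rewrite belast_rcons /= in vp.
case/path.splitP: vp => q1 q2 in pxp Up sub_ps Bp le_ps *.
rewrite rcons_cat cat_path !last_cat !last_rcons in pxp Bp.
case/andP: pxp => pxq1 pvq2.
rewrite size_rcons size_cat size_rcons in le_ps.
have [Av | Bv] := setUP ABv.
- have ltq : size (rcons q2 z) < size s.
    by rewrite size_rcons (leq_trans _ le_ps) // ltnS addSn ltnS leq_addl.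
  have [|x' [s' [dP les']]] := IHn v (rcons q2 z) (leq_trans ltq les_n) Av pvq2.
    by rewrite last_rcons.
  by exists x', s'; split=> //; apply: leq_trans les' (ltnW ltq).
- have ltq : size (rcons q1 v) < size s.
    by rewrite size_rcons (leq_trans _ le_ps) // ltnS leq_addr.
  have [|x' [s' [dP les']]] := IHn x (rcons q1 v) (leq_trans ltq les_n) Ax pxq1.
    by rewrite last_rcons.
  by exists x', s'; split=> //; apply: leq_trans les' (ltnW ltq).
Qed.

Lemma walk_backward_step {T : finType} {e : rel T} {A : {set T}}
    {x u v : T} {s : seq T} :
  (forall y, semicomplete_on e (in_nbh e y)) ->
  (forall y z, z \in A -> e y z -> y \in A) ->
  x \in A -> path e x s -> last x s = u -> e v u ->
  exists x' s', [/\ x' \in A, path e x' s', last x' s' = v & size s' <= size s].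
Proof.
move=> in_sc A_src Ax; elim/last_ind: s u => [|s w IHs] u.
  (* Here [u = x], and [v] lies in [A] itself: the walk restarts at [v], which is why the start may
     change. *)
  by move=> _ /= <- /(A_src _ _ Ax) Av; exists v, [::].
rewrite rcons_path last_rcons => /andP[pxs ew] <-{u} ev.
have [<- | neq] := eqVneq (last x s) v.
  by exists x, s; rewrite size_rcons leqnSn.
have /forall_inP/(_ (last x s)) := in_sc w.
rewrite inE => /(_ ew)/forall_inP/(_ v); rewrite inE => /(_ ev).
rewrite neq => /orP[ewv | evw].
  (* Replacing the last vertex [w] by [v] keeps the length. *)
  exists x, (rcons s v).
  by rewrite rcons_path last_rcons !size_rcons pxs ewv.
have [x' [s' [Ax' pxs' lx' les']]] := IHs _ pxs erefl evw.
by exists x', s'; rewrite size_rcons leqW.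
Qed.

Lemma walk_of_oriented_walk {T : finType} {e : rel T} {A : {set T}}
    {x : T} {s : seq T} :
  (forall y, semicomplete_on e (in_nbh e y)) ->
  (forall y z, z \in A -> e y z -> y \in A) ->
  x \in A -> path (adjacent e) x s ->
  exists x' s', [/\ x' \in A, path e x' s', last x' s' = last x s
                 & size s' <= nb_forward e x s].
Proof.
move=> in_sc A_src Ax; elim/last_ind: s => [|s w IHs].
  by exists x, [::].
rewrite rcons_path last_rcons => /andP[/IHs[x' [s' [Ax' pxs' lx' les']]] adj].
rewrite /nb_forward -cats1 pairmap_cat count_cat /= addn0 -/(nb_forward e x s).
(* An arc with an opposite counts as forward, so the second case has only the arc into
   [last x s]. *)
have [ew | new] := boolP (e (last x s) w).
  exists x', (rcons s' w).
  split=> //; first by rewrite rcons_path pxs' lx'.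
    by rewrite last_rcons.
  by rewrite size_rcons addn1.
have ew : e w (last x s) by case/orP: adj => // /(negP new).
rewrite addn0.
have [y [t [Ay pyt lt le_ts]]] :=
  walk_backward_step in_sc A_src Ax' pxs' lx' ew.
by exists y, t; split=> //; apply: leq_trans les'.
Qed.

Lemma strong_component_cover {T : finType} (e : rel T) (v : T) :
  exists2 C, strong_component e C & v \in C.
Proof.
have [|C maxC] := @maxset_exists T (strong_on e) [set v].
  by apply/forall_inP=> y /set1P->; apply/forall_inP=> z /set1P->.
by rewrite sub1set => vC; exists C.
Qed.

(** The strong component of [y] occurs in [Cs]; were it not the head, [e y z] would go from a later
    component back to the first. For empty [Cs] the default [set0] has no element [z]. *)
Lemma acyclic_ordering_head_source {T : finType} {e : rel T}
    {Cs : seq {set T}} {y z : T} :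
  acyclic_ordering e Cs -> z \in head set0 Cs -> e y z -> y \in head set0 Cs.
Proof.
case=> _ memCs; case: Cs memCs => [|C Cs] memCs /=; first by rewrite inE.
case/andP=> /allP acC _ Cz eyz.
have [B cB By] := strong_component_cover e y.
move: cB; rewrite -memCs inE => /predU1P[<- //|/acC].
by move/forall_inP/(_ _ Cz)/forall_inP/(_ _ By); rewrite eyz.
Qed.

Theorem theorem3p5 (T : finType) (e : rel T) (e_irr : irreflexive e)
  (e_conn : connected e) (e_lsc : locally_semicomplete e)
  (e_nstrong : ~~ strong e)
  (Cs : seq {set T}) (Cs_ord : acyclic_ordering e Cs)
  (x : T) (s : seq T)
  (P_path : oriented_path_between e (head set0 Cs) (last set0 Cs) x s) :
  dist e (head set0 Cs) (last set0 Cs) <= nb_forward e x s.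
Proof.
have /and5P[pxs _ Ax Bx _] := P_path.
have in_sc y : semicomplete_on e (in_nbh e y).
  by have /forallP/(_ y)/andP[] := e_lsc.
have A_src y z := acyclic_ordering_head_source (y := y) (z := z) Cs_ord.
have [x1 [s1 [Ax1 px1 lx1 les1]]] :=
  walk_of_oriented_walk in_sc A_src Ax pxs.
rewrite -lx1 in Bx.
(* The walk still ends where [P] does, but may repeat vertices or revisit the end components. *)
have [x2 [s2 [dP les2]]] := directed_path_of_walk Ax1 px1 Bx.
exact: leq_trans (dist_le dP) (leq_trans les2 les1).
Qed.
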